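(* Let $P_1,\dots,P_7$ be the seven eigenpoints of a regular ternary cubic form over $\mathbb{C}$, and suppose they are in a $(C_8)$ configuration. Then, up to a permutation of the points (preserving the $(C_8)$ configuration), $s_{12}\neq0$ and \[ P_7=s_{14}s_{24}\,(P_1\times P_2)-s_{12}s_{24}\,(P_1\times P_4)+s_{12}s_{14}\,(P_2\times P_4), \] and the lines $P_1\vee P_2$, $P_1\vee P_4$ and $P_1\vee P_6$ are orthogonal to, respectively, $P_3\vee P_4$, $P_2\vee P_5$ and $P_2\vee P_4$. In particular, \[ \langle P_1\times P_2,P_3\times P_4\rangle=0,\qquad \langle P_1\times P_4,P_2\times P_5\rangle=0,\qquad \langle P_1\times P_6,P_2\times P_4\rangle=0 . \]
   Context: Work in $\mathbb{P}^2_{\mathbb{C}}$. For a nonzero ternary cubic form $f$, the eigenscheme $E(f)\subset\mathbb{P}^2$ is defined by the $2\times2$ minors of $\begin{pmatrix}x&y&z\\ \partial_xf&\partial_yf&\partial_zf\end{pmatrix}$; its points are the eigenpoints of $f$. $f$ is regular if $E(f)$ is reduced of dimension $0$ (it then has $7$ points). $\langle (A,B,C),(A',B',C')\rangle=AA'+BB'+CC'$, $s_{ij}=\langle P_i,P_j\rangle$ (for chosen representing vectors), $\times$ is the cross product of representing vectors, and $P\vee Q$ is the line through $P,Q$. Lines $P\vee Q$ and $R\vee S$ are orthogonal if $\langle P\times Q,R\times S\rangle=0$. Equalities of points are equalities in $\mathbb{P}^2$. Seven distinct points $P_1,\dots,P_7$ are in a $(C_8)$ configuration if the triples with indices $(1,2,3),(1,4,5),(1,6,7),(2,4,6),(2,5,7),(3,4,7)$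 are aligned. *)

(* Defs.v *)
From mathcomp Require Import all_boot all_order all_algebra all_fingroup.
From mathcomp Require Import reals complex mpoly.

Set Implicit Arguments.
Unset Strict Implicit.
Unset Printing Implicit Defensive.

Import GRing.Theory.
Local Open Scope ring_scope.

(* Subschemes of P^2 given by a homogeneous ideal I of S = K[x, y, z]. *)

Section ProjectiveSubscheme.

Variable K : fieldType.
Implicit Types (I p q : {mpoly K[3]} -> Prop).

(* The points of Proj (S/I): homogeneous primes containing I but not the
   irrelevant ideal (x, y, z). *)
Record proj_point I p : Prop := ProjPoint {
  pp_zero : p 0;
  pp_add : forall g h, p g -> p h -> p (g + h);
  pp_mul : forall g h, p h -> p (g * h);
  pp_proper : ~ p 1;
  pp_prime : forall g h, p (g * h) -> p g \/ p h;
  pp_homog : forall g d, p g -> p (pihomog mdeg d g);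
  pp_relevant : exists i : 'I_3, ~ p 'X_i;
  pp_contains : forall g, I g -> p g }.

(* Krull dimension 0: there is a point, and no strict chain of two points. *)
Definition proj_dim0 I : Prop :=
  (exists p, proj_point I p) /\
  (forall p q, proj_point I p -> proj_point I q ->
     (forall g, p g -> q g) -> (forall g, q g -> p g)).

(* The coordinate ring of the chart D_+(x_i) is the degree-0 part of
   (S/I)[1/x_i]: its elements are the fractions g / x_i^d with g homogeneous
   of degree d, and such a fraction vanishes iff x_i^m g is in I for some m.
   The scheme is reduced iff these three rings have no nonzero nilpotent. *)
Definition proj_reduced I : Prop :=
  forall (i : 'I_3) (d : nat) (g : {mpoly K[3]}), g \is d.-homog ->
    (exists k m : nat, I ('X_i ^+ m * g ^+ k)) ->
    exists m : nat, I ('X_i ^+ m * g).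

End ProjectiveSubscheme.

Section Eigenscheme.

Variable K : fieldType.
Implicit Types (f g : {mpoly K[3]}) (u v P Q : 'rV[K]_3).

Definition eig_minor f (i j : 'I_3) : {mpoly K[3]} :=
  'X_i * f^`M(j) - 'X_j * f^`M(i).

Definition eig_ideal f g : Prop :=
  exists a : 'I_3 -> 'I_3 -> {mpoly K[3]},
    g = \sum_(i < 3) \sum_(j < 3 | (i < j)%N) a i j * eig_minor f i j.

Definition regular_form f : Prop :=
  proj_dim0 (eig_ideal f) /\ proj_reduced (eig_ideal f).

(* Points of P^2 are given by nonzero representing vectors; [same_point] is
   their equality in P^2, and in particular forces both vectors to be nonzero. *)
Definition same_point u v : Prop :=
  u != 0 /\ exists2 c : K, c != 0 & u = c *: v.

Definition eigenpoint f P : Prop :=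
  P != 0 /\ forall i j : 'I_3, (i < j)%N -> (eig_minor f i j).@[P 0] = 0.

(* The seven eigenpoints P_1, ..., P_7, as P_k = [P (idx k)]. *)
Definition idx (k : nat) : 'I_7 := inord k.-1.

Definition are_eigenpoints f (P : 'I_7 -> 'rV[K]_3) : Prop :=
  [/\ forall i, eigenpoint f (P i),
      forall i j, same_point (P i) (P j) -> i = j
    & forall Q, eigenpoint f Q -> exists i, same_point Q (P i)].

Definition dot u v : K := \sum_(i < 3) u 0 i * v 0 i.

Definition cross u v : 'rV[K]_3 :=
  \row_(k < 3) [:: u 0 1 * v 0 2 - u 0 2 * v 0 1;
                   u 0 2 * v 0 0 - u 0 0 * v 0 2;
                   u 0 0 * v 0 1 - u 0 1 * v 0 0]`_k.

(* The three points lie on a common line <l, -> = 0. *)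
Definition aligned u v w : Prop :=
  exists2 l : 'rV[K]_3, l != 0 & [/\ dot l u = 0, dot l v = 0 & dot l w = 0].

(* Orthogonality of the lines P1 v P2 and Q1 v Q2. *)
Definition orthogonal_lines P1 P2 Q1 Q2 : Prop :=
  dot (cross P1 P2) (cross Q1 Q2) = 0.

Definition C8 (P : 'I_7 -> 'rV[K]_3) : Prop :=
  let al i j k := aligned (P (idx i)) (P (idx j)) (P (idx k)) in
  [/\ forall i, P i != 0 & forall i j, same_point (P i) (P j) -> i = j] /\
  [/\ al 1 2 3, al 1 4 5 & al 1 6 7]%N /\ [/\ al 2 4 6, al 2 5 7 & al 3 4 7]%N.

End Eigenscheme.

(* Main.v *)
Require Import Defs.
From mathcomp Require Import all_boot all_order all_algebra all_fingroup.
From mathcomp Require Import reals complex mpoly.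
From mathcomp Require Import ring.

Set Implicit Arguments.
Unset Strict Implicit.
Unset Printing Implicit Defensive.

Import GRing.Theory.
Local Open Scope ring_scope.

(* P_1, P_2, P_4, P_7 are the vertices of a complete quadrangle with diagonal
   points P_3, P_5, P_6: four eigenpoints on a line would make all its points
   eigenpoints, so no three vertices are collinear. Choosing representatives
   a, b, c of P_1, P_2, P_4 with P_7 = a + b + c, the other three points are
   a + b, a + c, b + c. Up to a factor 2 the gradient of f is u |-> L u u for
   a symmetric bilinear L such that <L u v, w> is totally symmetric, and the
   eigenpoints are the u with L u u = mu u. Expanding these seven equations and
   using the symmetry of <L u v, w> gives a system in the Gram matrix of
   (a, b, c), whose nondegenerate solutions satisfy
     s_17 s_24 = s_27 s_14 = s_47 s_12,
   i.e. opposite sides of the quadrangle are orthogonal, each vertex being the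
   orthocentre of the other three. The formula for P_7 requires two of s_12,
   s_14, s_24 to be nonzero, which is achieved by relabelling the vertices. *)

(** * Derivatives of homogeneous polynomials and Euler's identity *)

Section Forms.

Variables (K : fieldType) (n : nat).
Implicit Types f : {mpoly K[n]}.

Lemma dhomog_mderiv d f i : f \is d.+1.-homog -> f^`M(i) \is d.-homog.
Proof.
move=> /dhomogP fd; apply/dhomogP => m; rewrite mcoeff_msupp mcoeff_mderiv => nz.
have /fd /= : (m + U_(i))%MM \in msupp f.
  by rewrite mcoeff_msupp; apply: contraNneq nz => ->; rewrite mul0rn.
by rewrite mdegD mdeg1 addn1 => -[].
Qed.

(** On a monomial, multiplying the [i]-th derivative by the [i]-th variable multiplies by the [i]-th
    exponent, and the exponents add up to the degree. *)
Lemma euler_identity d f :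
  f \is d.-homog -> \sum_i 'X_i * f^`M(i) = f *+ d.
Proof.
move=> /dhomogP fd; rewrite [in RHS](mpolyE f) -sumrMnl.
transitivity (\sum_i \sum_(m <- msupp f) 'X_i * ((m i)%:R * f@_m *: 'X_[m - U_(i)])).
  by apply: eq_bigr => i _; rewrite /mderiv mulr_sumr.
rewrite exchange_big /= big_seq [RHS]big_seq; apply: eq_bigr => m mf.
have <- : mdeg m = d := fd m mf.
rewrite -[RHS]scaler_nat mdegE natr_sum scaler_suml; apply: eq_bigr => i _.
(* Subtraction of multi-indices is truncated, so a zero exponent is treated apart; its coefficient
   vanishes anyway. *)
have [mi0|mi0] := eqVneq (m i) 0%N; first by rewrite mi0 mul0r !scale0r mulr0.
rewrite -scalerAr -mpolyXD -scalerA; congr (_ *: (_ *: 'X_[_])).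
by rewrite addmC submK // lep1mP.
Qed.

Lemma dhomog0_const f : f \is 0.-homog -> f = (f@_0)%:MP.
Proof.
move=> f0; apply/mpolyP => m; rewrite mcoeffC.
have [->|m0] := eqVneq m 0%MM; first by rewrite mulr1.
by rewrite mulr0 (dhomog_nemf_coeff f0) // mdeg_eq0.
Qed.

End Forms.

(** * The symmetric trilinear form attached to a cubic *)

Section Polar.

Variable K : numFieldType.
Implicit Types (f : {mpoly K[3]}) (u v w : 'rV[K]_3).

Definition gradv f u : 'rV[K]_3 := \row_j (f^`M(j)).@[u 0].

(** The third partial derivatives of a cubic are constants. [L u v] contracts this tensor with [u]
    and [v], and its symmetries come from commuting derivatives. *)
Lemma cubic_polarization f : f \is 3.-homog ->
  exists L : 'rV[K]_3 -> 'rV[K]_3 -> 'rV[K]_3,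
    [/\ forall u v w, L (u + v) w = L u w + L v w,
        forall k u v, L (k *: u) v = k *: L u v,
        forall u v, L u v = L v u,
        forall u v w, dot (L u v) w = dot (L u w) v
      & (forall u, L u u = 2 *: gradv f u) /\
        ((forall u v, L u v = 0) -> f = 0)].
Proof.
move=> f3; pose c i j k := (f^`M(k)^`M(j)^`M(i))@_0.
have cE i j k : f^`M(k)^`M(j)^`M(i) = (c i j k)%:MP.
  by apply: dhomog0_const; do 3!apply: dhomog_mderiv.
have c12 i j k : c i j k = c j i k by rewrite /c mderiv_comm.
have c23 i j k : c i j k = c i k j by rewrite /c [f^`M(k)^`M(j)]mderiv_comm.
(* Euler's identity, in degree 2 for a first derivative and in degree 1 for a second one, recovers
   twice the gradient from the tensor. *)
have f2E k : f^`M(k) *+ 2 = \sum_j 'X_j * \sum_i 'X_i * (c i j k)%:MP.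
  rewrite -(@euler_identity _ _ 2) ?dhomog_mderiv //; apply: eq_bigr => j _.
  rewrite -[f^`M(k)^`M(j)]mulr1n -(@euler_identity _ _ 1) ?dhomog_mderiv //.
    by congr (_ * _); apply: eq_bigr => i _; rewrite cE.
pose L u v : 'rV[K]_3 := \row_k \sum_j \sum_i u 0 i * v 0 j * c i j k.
exists L; split.
- move=> u v w; apply/rowP => k; rewrite !mxE -big_split; apply: eq_bigr => j _.
  rewrite -big_split; apply: eq_bigr => i _ /=.
  by rewrite !mxE; ring.
- move=> x u v; apply/rowP => k; rewrite !mxE mulr_sumr; apply: eq_bigr => j _.
  by rewrite mulr_sumr; apply: eq_bigr => i _ /=; rewrite !mxE; ring.
- move=> u v; apply/rowP => k; rewrite !mxE exchange_big; apply: eq_bigr => j _.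
  by apply: eq_bigr => i _; rewrite c12; ring.
- move=> u v w; rewrite /dot.
  under eq_bigr => k _ do rewrite mxE mulr_suml.
  under [RHS]eq_bigr => k _ do rewrite mxE mulr_suml.
  rewrite exchange_big; apply: eq_bigr => j _; apply: eq_bigr => k _.
  by rewrite !mulr_suml; apply: eq_bigr => i _; rewrite c23; ring.
split=> [u|L0].
  apply/rowP => k; rewrite !mxE -[2 * _]/(2%:R * _) mulr_natl -mevalMn f2E.
  rewrite raddf_sum /=; apply: eq_bigr => j _.
  rewrite mevalM mevalXU raddf_sum /= mulr_sumr; apply: eq_bigr => i _.
  by rewrite mevalM mevalXU mevalC; ring.
(* Evaluating [L] on standard basis vectors reads off the entries of the tensor. *)
have c0 i j k : c i j k = 0.
  have /rowP/(_ k) := L0 (delta_mx 0 i) (delta_mx 0 j).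
  rewrite !mxE (bigD1 j) //= (bigD1 i) //= !mxE !eqxx !mul1r.
  rewrite [X in _ + X + _]big1 => [|i' ne]; last by rewrite !mxE eqxx (negPf ne) !mul0r.
  rewrite big1 ?addr0 // => j' ne; rewrite big1 // => i' _.
  by rewrite !mxE eqxx (negPf ne) mulr0 mul0r.
(* Characteristic 0 cancels Euler's factors 3 and 2; the argument [m] stands for the factor
   [m.+1]. *)
have torsion (p : {mpoly K[3]}) m : p *+ m.+1 = 0 -> p = 0.
  move/eqP; rewrite -scaler_nat scaler_eq0 Num.Theory.pnatr_eq0 /=; exact/eqP.
apply: (torsion _ 2%N); rewrite -(euler_identity f3) big1 // => k _.
rewrite (torsion (f^`M(k)) 1%N) ?mulr0 // f2E big1 // => j _.
by rewrite big1 ?mulr0 // => i _; rewrite c0 mpolyC0 mulr0.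
Qed.

End Polar.

(** * Dot product, cross product and determinant in dimension three *)

Section Vectors.

Variable K : fieldType.
Implicit Types u v w p a b c : 'rV[K]_3.

Definition det3 u v w : K := dot u (cross v w).

Lemma ord3P (i : 'I_3) : [\/ i = 0, i = 1 | i = 2].
Proof.
case: i => -[|[|[|m]]] lti //; first by apply: Or31; apply: val_inj.
  by apply: Or32; apply: val_inj.
by apply: Or33; apply: val_inj.
Qed.

Lemma dotE u v : dot u v = u 0 0 * v 0 0 + u 0 1 * v 0 1 + u 0 2 * v 0 2.
Proof.
rewrite /dot !big_ord_recl big_ord0 addr0 addrA.
have -> : lift ord0 ord0 = 1 :> 'I_3 by exact: val_inj.
by have -> : lift ord0 (lift ord0 ord0) = 2 :> 'I_3 by exact: val_inj.
Qed.

Lemma row3P u v :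
  u 0 0 = v 0 0 -> u 0 1 = v 0 1 -> u 0 2 = v 0 2 -> u = v.
Proof. by move=> e0 e1 e2; apply/rowP => i; case: (ord3P i) => ->. Qed.

Lemma row3_neq0 u : u != 0 -> [\/ u 0 0 != 0, u 0 1 != 0 | u 0 2 != 0].
Proof.
move=> u0; have [e0|] := eqVneq (u 0 0) 0; last by constructor.
have [e1|] := eqVneq (u 0 1) 0; last by constructor.
have [e2|] := eqVneq (u 0 2) 0; last by constructor.
by case/eqP: u0; apply: row3P; rewrite mxE.
Qed.

Ltac coords := rewrite /det3 ?dotE /cross ?mxE /= ?mxE /=.
Ltac vring := apply: row3P; coords; ring.

Lemma dotC u v : dot u v = dot v u. Proof. coords; ring. Qed.

Lemma dotDl u v w : dot (u + v) w = dot u w + dot v w.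
Proof. coords; ring. Qed.

Lemma dotDr u v w : dot u (v + w) = dot u v + dot u w.
Proof. coords; ring. Qed.

Lemma dotZl k u v : dot (k *: u) v = k * dot u v.
Proof. coords; ring. Qed.

Lemma dotZr k u v : dot u (k *: v) = k * dot u v.
Proof. coords; ring. Qed.

Lemma dot0r u : dot u 0 = 0. Proof. coords; ring. Qed.

Lemma dot_eq0 u : (forall v, dot u v = 0) -> u = 0.
Proof.
move=> u0; apply/rowP => i; have := u0 (delta_mx 0 i); rewrite dotE !mxE !eqxx /=.
by case: (ord3P i) => -> /=; rewrite ?(mulr1, mulr0, addr0, add0r).
Qed.

Lemma crossC u v : cross u v = - cross v u. Proof. vring. Qed.

Lemma crossDl u v w : cross (u + v) w = cross u w + cross v w.
Proof. vring. Qed.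

Lemma crossDr u v w : cross u (v + w) = cross u v + cross u w.
Proof. vring. Qed.

Lemma crossZl k u v : cross (k *: u) v = k *: cross u v.
Proof. vring. Qed.

Lemma crossZr k u v : cross u (k *: v) = k *: cross u v.
Proof. vring. Qed.

Lemma crossvv u : cross u u = 0. Proof. vring. Qed.

Lemma cross0l u : cross 0 u = 0. Proof. vring. Qed.

Lemma dot_cross u v w p :
  dot (cross u v) (cross w p) = dot u w * dot v p - dot u p * dot v w.
Proof. coords; ring. Qed.

Lemma double_cross u v w : cross u (cross v w) = dot u w *: v - dot u v *: w.
Proof. vring. Qed.

Lemma det3_rot u v w : det3 u v w = det3 v w u. Proof. coords; ring. Qed.

Lemma det3_swap u v w : det3 u v w = - det3 v u w. Proof. coords; ring. Qed.

(** Cramer's rule without division. It holds for all vectors; a nonzero determinant is cancelled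
    only where coordinates in a basis are wanted. *)
Lemma cramer3 a b c p :
  det3 a b c *: p = det3 p b c *: a + det3 a p c *: b + det3 a b p *: c.
Proof. vring. Qed.

Lemma cross_eq0_parallel u v : cross u v = 0 -> v != 0 -> exists k, u = k *: v.
Proof.
move=> uv0 v0.
have e0 : u 0 1 * v 0 2 - u 0 2 * v 0 1 = 0.
  by move/rowP/(_ 0): uv0; rewrite /cross !mxE.
have e1 : u 0 2 * v 0 0 - u 0 0 * v 0 2 = 0.
  by move/rowP/(_ 1): uv0; rewrite /cross !mxE.
have e2 : u 0 0 * v 0 1 - u 0 1 * v 0 0 = 0.
  by move/rowP/(_ 2): uv0; rewrite /cross !mxE.
move: e0 e1 e2 => /subr0_eq e0 /subr0_eq e1 /subr0_eq e2.
case: (row3_neq0 v0) => vk; [exists (u 0 0 / v 0 0) | exists (u 0 1 / v 0 1)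
  | exists (u 0 2 / v 0 2)]; apply: row3P; rewrite mxE; apply: (mulIf vk);
  by rewrite mulrAC divfK // ?e0 ?e1 ?e2 1?mulrC // -?e0 -?e1 -?e2 1?mulrC.
Qed.

Lemma same_point_cross u v :
  u != 0 -> v != 0 -> cross u v = 0 -> same_point u v.
Proof.
move=> u0 v0 /cross_eq0_parallel-/(_ v0) [k uE]; split=> //; exists k => //.
by apply: contraNneq u0 => k0; rewrite uE k0 scale0r.
Qed.

Lemma det3_free a b c x y z : det3 a b c != 0 ->
  x *: a + y *: b + z *: c = 0 -> [/\ x = 0, y = 0 & z = 0].
Proof.
move=> D0 e; have coef (k : K) n :
    dot n (x *: a + y *: b + z *: c) = k * det3 a b c -> k = 0.
  by rewrite e dot0r => /esym/eqP; rewrite mulf_eq0 (negPf D0) orbF => /eqP.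
by split; [apply: (coef x (cross b c)) | apply: (coef y (cross c a))
  | apply: (coef z (cross a b))]; coords; ring.
Qed.

Lemma det3_neq0 u v w : det3 u v w != 0 -> [/\ u != 0, v != 0 & w != 0].
Proof.
by move=> D; split; apply: contraNneq D => ->; apply/eqP; coords; ring.
Qed.

Lemma det3_dot_eq0 a b c w : det3 a b c != 0 ->
  dot a w = 0 -> dot b w = 0 -> dot c w = 0 -> w = 0.
Proof.
move=> D aw bw cw; apply: dot_eq0 => v; apply: (mulfI D).
rewrite mulr0 -dotZr cramer3 !(dotDr, dotZr) (dotC w a) (dotC w b) (dotC w c).
by rewrite aw bw cw; ring.
Qed.

Lemma aligned_swap12 u v w : aligned u v w -> aligned v u w.
Proof. by case=> l l0 [lu lv lw]; exists l. Qed.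

Lemma aligned_swap23 u v w : aligned u v w -> aligned u w v.
Proof. by case=> l l0 [lu lv lw]; exists l. Qed.

Lemma aligned_swap13 u v w : aligned u v w -> aligned w v u.
Proof. by case=> l l0 [lu lv lw]; exists l. Qed.

(** Each coordinate of the cross product is the determinant of [u], [v] and a standard basis
    vector. *)
Lemma cross_neq0_det3 u v : cross u v != 0 -> exists w, det3 u v w != 0.
Proof.
case/row3_neq0 => nz; [exists (delta_mx 0 0) | exists (delta_mx 0 1)
  | exists (delta_mx 0 2)]; apply: contraNneq nz; coords;
  rewrite !(mulr1n, mulr0n) => e; apply/eqP; rewrite -e; ring.
Qed.

(** By cofactor expansion, each coordinate of [l] times the determinant is a combination of the
    products of [l] with [u], [v], [w]; some coordinate of [l] is nonzero. *)
Lemma aligned_det3 u v w : aligned u v w -> det3 u v w = 0.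
Proof.
case=> l /row3_neq0 l0 []; rewrite !dotE => eu ev ew.
have key (x : K) n1 n2 n3 : x != 0 ->
    x * det3 u v w = n1 * dot l u + n2 * dot l v + n3 * dot l w -> det3 u v w = 0.
  move=> x0; rewrite !dotE eu ev ew !mulr0 !addr0 => /eqP.
  by rewrite mulf_eq0 (negPf x0) => /eqP.
case: l0 => x0.
- apply: (key _ (cross v w 0 0) (cross w u 0 0) (cross u v 0 0) x0); coords; ring.
- apply: (key _ (cross v w 0 1) (cross w u 0 1) (cross u v 0 1) x0); coords; ring.
- apply: (key _ (cross v w 0 2) (cross w u 0 2) (cross u v 0 2) x0); coords; ring.
Qed.

Lemma det3_eq0_span u v w : cross u v != 0 -> det3 u v w = 0 ->
  exists x y, w = x *: u + y *: v.
Proof.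
case/cross_neq0_det3=> e D w0; exists (det3 w v e / det3 u v e), (det3 u w e / det3 u v e).
apply: (scalerI D); rewrite cramer3 w0 scale0r addr0 scalerDr !scalerA.
by rewrite ![_ * (_ / _)]mulrC !divfK.
Qed.

(** The first alignment puts [p] in the span of [a] and [b]; the second one, expanded, says that its
    two coordinates there are equal. *)
Lemma diagonal_point a b c p : det3 a b c != 0 -> p != 0 ->
  det3 a b p = 0 -> det3 p c (a + b + c) = 0 ->
  exists2 k, k != 0 & p = k *: (a + b).
Proof.
move=> D p0 e1 e2; have e : det3 a p c = det3 p b c.
  by apply/subr0_eq; rewrite -e2; coords; ring.
have pE : p = (det3 p b c / det3 a b c) *: (a + b).
  apply: (scalerI D); rewrite cramer3 e1 scale0r addr0 e !scalerDr !scalerA.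
  by rewrite ![_ * (_ / _)]mulrC !divfK.
by exists (det3 p b c / det3 a b c) => //; apply: contraNneq p0 => k0;
  rewrite pE k0 scale0r.
Qed.

End Vectors.

(** * The equations linking the Gram matrix to the eigenvalues *)

Section Scalars.

Variable K : fieldType.
Implicit Types A B C x y z p q r m : K.

Let cancel2 x y : x != 0 -> x * y = 0 -> y = 0.
Proof. by move=> x0 /eqP; rewrite mulf_eq0 (negPf x0) => /eqP. Qed.

(** This is the case [p = 0] of the system solved in [gram_system], split according to the vanishing
    of [q] and [r]. Vectors can be isotropic, so nondegeneracy only says that no row of the Gram
    matrix is zero. *)
Lemma gram_system_degenerate A B C x y z q r m :
  [/\ q * y = 0, r * x = 0, q * A + m * x = 0 & r * A + m * y = 0] ->
  [/\ (m - q) * x = 0, (m - r) * y = 0, r * B + (m - q) * z = 0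
    & q * C + (m - r) * z = 0] ->
  ~ [/\ A = 0, x = 0 & y = 0] -> ~ [/\ q = 0, r = 0 & m = 0] ->
  (A + x + y) * z = (x + B + z) * y /\ (A + x + y) * z = (y + z + C) * x.
Proof.
move=> [qy rx e12 e14] [e21 e41 e24 e42] nA nz.
have [q0|q0] := eqVneq q 0; have [r0|r0] := eqVneq r 0; subst.
- have m0 : m != 0 by apply/eqP => m0; case: nz.
  have x0 : x = 0 by apply: (cancel2 m0); rewrite -e12; ring.
  have y0 : y = 0 by apply: (cancel2 m0); rewrite -e14; ring.
  have z0 : z = 0 by apply: (cancel2 m0); rewrite -e24; ring.
  by subst; split; ring.
- have x0 := cancel2 r0 rx; subst.
  have [mr|mr] := eqVneq m r; last first.
    have y0 : y = 0 by apply: cancel2 e41; rewrite subr_eq0.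
    by subst; case: nA; split=> //; apply: (cancel2 r0); rewrite -e14; ring.
  subst; have Ay : A + y = 0 by apply: (cancel2 r0); rewrite -e14; ring.
  have Bz : B + z = 0 by apply: (cancel2 r0); rewrite -e24; ring.
  by rewrite addr0 add0r Ay Bz; split; ring.
- have y0 := cancel2 q0 qy; subst.
  have [mq|mq] := eqVneq m q; last first.
    have x0 : x = 0 by apply: cancel2 e21; rewrite subr_eq0.
    by subst; case: nA; split=> //; apply: (cancel2 q0); rewrite -e12; ring.
  subst; have Ax : A + x = 0 by apply: (cancel2 q0); rewrite -e12; ring.
  have Cz : z + C = 0 by apply: (cancel2 q0); rewrite -e42; ring.
  by rewrite addr0 add0r Ax Cz; split; ring.
by case: nA; have x0 := cancel2 r0 rx; have y0 := cancel2 q0 qy; subst; split=> //;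
  apply: (cancel2 r0); rewrite -e14; ring.
Qed.

Lemma gram_system A B C x y z p q r m :
  p * z = q * y -> q * y = r * x ->
  [/\ q * A + (m - p) * x = 0, r * A + (m - p) * y = 0,
      p * B + (m - q) * x = 0 & r * B + (m - q) * z = 0] ->
  p * C + (m - r) * y = 0 -> q * C + (m - r) * z = 0 ->
  [/\ ~ [/\ A = 0, x = 0 & y = 0], ~ [/\ B = 0, x = 0 & z = 0]
    & ~ [/\ C = 0, y = 0 & z = 0]] ->
  ~ [/\ p = 0, q = 0, r = 0 & m = 0] ->
  (A + x + y) * z = (x + B + z) * y /\ (A + x + y) * z = (y + z + C) * x.
Proof.
move=> zy yx [e12 e14 e21 e24] e41 e42 [nA nB nC] nz.
have zero U V : V = 0 -> U = V -> U = 0 by move=> -> ->.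
have [p0|p0] := eqVneq p 0.
  have qy : q * y = 0 by rewrite -zy p0 mul0r.
  apply: (@gram_system_degenerate _ _ _ _ _ _ q r m) => //.
  - split=> //; [by rewrite -yx | apply: zero e12 _ | apply: zero e14 _];
      rewrite p0; ring.
  - by split=> //; [apply: zero e21 _ | apply: zero e41 _]; rewrite p0; ring.
  by case=> *; case: nz.
have [q0|q0] := eqVneq q 0.
  have qy : q * y = 0 by rewrite q0 mul0r.
  (* Exchange [a] and [b]: this swaps [A] with [B], [y] with [z] and [p] with [q]. *)
  have [||//||E1 E2] := @gram_system_degenerate B A C x z y p r m.
  - split; [by rewrite zy | by rewrite -yx | apply: zero e21 _ | apply: zero e24 _];
      rewrite q0; ring.
  - by split=> //; [apply: zero e12 _ | apply: zero e42 _]; rewrite q0; ring.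
  - by case=> *; case: nz.
  split; first by rewrite [in RHS](addrC x) E1; ring.
  have -> : (A + x + y) * z = (x + A + y) * z by ring.
  by rewrite -E1 E2; ring.
have [r0|r0] := eqVneq r 0.
  have qy : q * y = 0 by rewrite yx r0 mul0r.
  (* Rotate the vectors to [c], [a], [b], which brings [r] to the place of [p]. *)
  have [||||E1 E2] := @gram_system_degenerate C A B y z x p q m.
  - split; [by rewrite zy | by [] | apply: zero e41 _ | apply: zero e42 _];
      rewrite r0; ring.
  - by split=> //; [apply: zero e14 _ | apply: zero e24 _]; rewrite r0; ring.
  - by case=> *; case: nC.
  - by case=> *; case: nz.
  have E3 : (A + x + y) * z = (y + A + x) * z by ring.
  by rewrite E3 -E1; split; [rewrite E2|]; ring.
(* With [p], [q], [r] invertible, every Gram entry is a multiple of [x]. *)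
have zE : z = r * x / p by rewrite -yx -zy mulrC mulKf.
have yE : y = r * x / q by rewrite -yx mulrC mulKf.
have AE : A = (p - m) * x / q.
  apply/subr0_eq/(cancel2 q0); rewrite -e12; field; exact: q0.
have BE : B = (q - m) * x / p.
  apply/subr0_eq/(cancel2 p0); rewrite -e21; field; exact: p0.
have CE : C = (r - m) * y / p.
  apply/subr0_eq/(cancel2 p0); rewrite -e41; field; exact: p0.
by rewrite CE zE AE BE yE; split; field; rewrite p0 q0.
Qed.

End Scalars.

(** * Eigenvectors of the quadratic map [L u u], on a line and on a quadrangle *)

Section EigenvectorsOfPolarForm.

Variables (K : numFieldType) (L : 'rV[K]_3 -> 'rV[K]_3 -> 'rV[K]_3).
Hypothesis LDl : forall u v w, L (u + v) w = L u w + L v w.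
Hypothesis LZl : forall k u v, L (k *: u) v = k *: L u v.
Hypothesis LC : forall u v, L u v = L v u.
Hypothesis Lsym : forall u v w, dot (L u v) w = dot (L u w) v.
Implicit Types u v p a b c : 'rV[K]_3.

Definition eigenvec p := exists mu, L p p = mu *: p.

Lemma eigenvecZ k p : k != 0 -> eigenvec (k *: p) <-> eigenvec p.
Proof.
have scale x q : eigenvec q -> eigenvec (x *: q).
  by case=> mu e; exists (x * mu); rewrite LZl LC LZl e !scalerA; congr (_ *: _); ring.
move=> k0; split=> [/(scale k^-1)|]; last exact: scale.
by rewrite scalerA mulVf // scale1r.
Qed.

Lemma polar_double u v m1 m2 m :
  L u u = m1 *: u -> L v v = m2 *: v -> L (u + v) (u + v) = m *: (u + v) ->
  2 *: L u v = (m - m1) *: u + (m - m2) *: v.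
Proof.
move=> eu ev e; have -> : 2 *: L u v = m *: (u + v) - L u u - L v v.
  rewrite -e LDl [L u (_ + _)]LC [L v (_ + _)]LC !LDl [L v u]LC.
  by apply/rowP => i; rewrite !mxE; ring.
by rewrite eu ev; apply/rowP => i; rewrite !mxE; ring.
Qed.

(** The fourth eigenvector forces the eigenvalue of [u + v] to be the sum [m1 + m2]; then
    [u + s *: v] is an eigenvector with eigenvalue [m1 + s * m2]. *)
Lemma eigenvec_line u v k s : cross u v != 0 -> k != 0 -> k != 1 ->
  eigenvec u -> eigenvec v -> eigenvec (u + v) -> eigenvec (u + k *: v) ->
  eigenvec (u + s *: v).
Proof.
case/cross_neq0_det3=> n D k0 k1 [m1 e1] [m2 e2] [m3 e3] [m4 e4].
have eL := polar_double e1 e2 e3.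
have expand x : L (u + x *: v) (u + x *: v) =
    (m1 + x * (m3 - m1)) *: u + (x ^+ 2 * m2 + x * (m3 - m2)) *: v.
  transitivity (L u u + x *: (2 *: L u v) + x ^+ 2 *: L v v).
    rewrite LDl LZl [L u (_ + _)]LC [L v (_ + _)]LC !LDl !LZl [L v u]LC.
    by apply/rowP => i; rewrite !mxE; ring.
  by rewrite eL e1 e2; apply/rowP => i; rewrite !mxE; ring.
have [|f1 f2 _] := @det3_free _ u v n (m1 + k * (m3 - m1) - m4)
    (k ^+ 2 * m2 + k * (m3 - m2) - k * m4) 0 D.
  transitivity (L (u + k *: v) (u + k *: v) - m4 *: (u + k *: v)); last by rewrite e4 subrr.
  by rewrite expand; apply/rowP => i; rewrite !mxE; ring.
(* Proportionality of the coordinates at [k] amounts to [k * (1 - k) * (m1 + m2 - m3) = 0]. *)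
have m3E : m3 = m1 + m2.
  apply/subr0_eq; have k10 : k * (1 - k) != 0 by rewrite mulf_neq0 // subr_eq0 eq_sym.
  apply: (mulfI k10); rewrite mulr0.
  have : k ^+ 2 * m2 + k * (m3 - m2) - k * m4 - k * (m1 + k * (m3 - m1) - m4) = 0.
    by rewrite f1 f2 mulr0 subrr.
  by move=> <-; ring.
exists (m1 + s * m2); rewrite expand m3E.
by apply/rowP => i; rewrite !mxE; ring.
Qed.

Lemma polar_basis_eq0 a b c : det3 a b c != 0 ->
  [/\ L a a = 0, L b b = 0 & L c c = 0] ->
  [/\ L a b = 0, L a c = 0 & L b c = 0] -> forall u v, L u v = 0.
Proof.
move=> D [aa bb cc] [ab ac bc].
have zero w : L a w = 0 -> L b w = 0 -> L c w = 0 -> forall u, L u w = 0.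
  move=> wa wb wc u; apply: (scalerI D).
  by rewrite -LZl cramer3 !LDl !LZl wa wb wc !scaler0 !addr0.
by move=> u v; apply: (zero v); rewrite LC; apply: (zero _); rewrite // LC.
Qed.

(* With a, b, c, a+b, a+c, b+c, a+b+c all eigenvectors, the eigenvalues of the
   last four determine the first three; the symmetry of the trilinear form
   dot (L u v) w on a, b, c then becomes the hypotheses of [gram_system]. *)
Lemma quadrangle_orthocentric a b c : det3 a b c != 0 ->
  ~ (forall u v, L u v = 0) ->
  [/\ eigenvec a, eigenvec b & eigenvec c] ->
  [/\ eigenvec (a + b), eigenvec (a + c) & eigenvec (b + c)] ->
  eigenvec (a + b + c) ->
  let d := a + b + c in
  dot a d * dot b c = dot b d * dot a c /\ dot a d * dot b c = dot c d * dot a b.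
Proof.
move=> D L0 [[ma ea] [mb eb] [mc ec]] [[mab eab] [mac eac] [mbc ebc]] [t et] d.
have Lab := polar_double ea eb eab; have Lac := polar_double ea ec eac.
have Lbc := polar_double eb ec ebc.
(* Compare the coordinates of [L d d] and [t *: d] in the basis [a], [b], [c]. *)
have [|fa fb fc] := @det3_free _ a b c (mab + mac - ma - t) (mab + mbc - mb - t)
    (mac + mbc - mc - t) D.
  transitivity (L d d - t *: d); last by rewrite et subrr.
  transitivity (L a a + L b b + L c c + 2 *: L a b + 2 *: L a c + 2 *: L b c - t *: d).
    by rewrite ea eb ec Lab Lac Lbc /d; apply/rowP => i; rewrite !mxE; ring.
  have Ld x : L d x = L a x + L b x + L c x by rewrite !LDl.
  congr (_ - _); rewrite [in RHS]Ld (LC a d) (LC b d) (LC c d) !Ld.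
  by rewrite [L b a]LC [L c a]LC [L c b]LC; apply/rowP => i; rewrite !mxE; ring.
have maE : ma = mab + mac - t by apply/esym/subr0_eq; rewrite -fa; ring.
have mbE : mb = mab + mbc - t by apply/esym/subr0_eq; rewrite -fb; ring.
have mcE : mc = mac + mbc - t by apply/esym/subr0_eq; rewrite -fc; ring.
(* In these terms twice [L a b], [L a c], [L b c] is [q a + p b], [r a + p c], [r b + q c]. The
   constant [m] gives the equations such as [2 <L a b, a> = 2 <L a a, b>] the uniform shape
   [q <a,a> + (m - p) <a,b> = 0]. *)
pose p := t - mbc; pose q := t - mac; pose r := t - mab.
pose m := 2 * (p + q + r) - 2 * t.
have dotL2 u v w : dot (2 *: L u v) w = dot (2 *: L u w) v.
  by rewrite !dotZl Lsym.
have dotL3 u v w : dot (2 *: L u v) w = dot (2 *: L v w) u.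
  by rewrite LC dotL2.
have dotL1 u v mu : L u u = mu *: u -> dot (2 *: L u v) u = 2 * (mu * dot u v).
  by move=> e; rewrite dotL2 e !dotZl.
have dotL1' u v mu : L v v = mu *: v -> dot (2 *: L u v) v = 2 * (mu * dot v u).
  by move=> e; rewrite LC; apply: dotL1.
have sab := dotL1 a b ma ea; have sba := dotL1' a b mb eb.
have sac := dotL1 a c ma ea; have sca := dotL1' a c mc ec.
have sbc := dotL1 b c mb eb; have scb := dotL1' b c mc ec.
have tac := dotL2 a b c; have tbc := dotL3 a b c.
move: sab sba sac sca sbc scb tac tbc; rewrite Lab Lac Lbc !(dotDl, dotZl).
rewrite (dotC b a) (dotC c a) (dotC c b) => sab sba sac sca sbc scb tac tbc.
have nz w : w != 0 -> [/\ dot a w = 0, dot b w = 0 & dot c w = 0] -> False.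
  by move=> w0 [aw bw cw]; case/eqP: w0; apply: det3_dot_eq0 D aw bw cw.
have [a0 b0 c0] := det3_neq0 D.
rewrite /d !dotDr (dotC b a) (dotC c a) (dotC c b).
have move0 (x y l : K) : x = y -> l = x - y -> l = 0 by move=> -> ->; rewrite subrr.
have qr : q * dot a c = r * dot a b.
  by apply/subr0_eq/(move0 _ _ _ tac); rewrite maE mbE mcE /q /r; ring.
have pr : p * dot b c = r * dot a b.
  by apply/subr0_eq/(move0 _ _ _ tbc); rewrite maE mbE mcE /p /r; ring.
apply: (@gram_system _ _ _ _ _ _ _ p q r m) => //.
- by rewrite pr.
- split; [apply: move0 sab _ | apply: move0 sac _ | apply: move0 sba _
    | apply: move0 sbc _]; rewrite ?maE ?mbE ?mcE /m /p /q /r; ring.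
- by apply: move0 sca _; rewrite maE mcE /m /p /q /r; ring.
- by apply: move0 scb _; rewrite mbE mcE /m /p /q /r; ring.
- by split=> -[]*; [apply: (nz a a0) | apply: (nz b b0) | apply: (nz c c0)];
    split=> //; rewrite dotC.
(* If [p], [q], [r], [m] all vanish, then so do [t] and all the other eigenvalues, which makes [L]
   zero on a basis. *)
case=> p0 q0 r0 m0; apply: L0.
have t0 : t = 0.
  have : (2 : K) * t = 0 by move: m0; rewrite /m p0 q0 r0 => /subr0_eq <-; ring.
  by move/eqP; rewrite mulf_eq0 Num.Theory.pnatr_eq0 => /eqP.
have mabE : mab = 0 by rewrite -(subr0_eq r0).
have macE : mac = 0 by rewrite -(subr0_eq q0).
have mbcE : mbc = 0 by rewrite -(subr0_eq p0).
have half w : 2 *: w = 0 -> w = 0 :> 'rV[K]_3.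
  by move/eqP; rewrite scaler_eq0 Num.Theory.pnatr_eq0 => /eqP.
move: maE mbE mcE; rewrite mabE macE mbcE t0 !addr0 subr0 => maE mbE mcE.
apply: (polar_basis_eq0 D); first by rewrite ea eb ec maE mbE mcE !scale0r.
by split; apply: half; rewrite ?(Lab, Lac, Lbc) ?(mabE, macE, mbcE) ?(maE, mbE, mcE) subr0;
  rewrite !scale0r addr0.
Qed.

End EigenvectorsOfPolarForm.

(** * The orthocentre formula and orthogonality of lines *)

Section Orthocentre.

Variable K : fieldType.
Implicit Types u v w : 'rV[K]_3.

Lemma det3Z x y z u v w : det3 (x *: u) (y *: v) (z *: w) = x * y * z * det3 u v w.
Proof. rewrite /det3 crossZl crossZr !dotZl !dotZr; ring. Qed.

Lemma span_coef_neq0 u v w x y : w = x *: u + y *: v ->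
  cross w v != 0 -> cross w u != 0 -> x != 0 /\ y != 0.
Proof.
move=> -> wv wu; split; [apply: contraNneq wv | apply: contraNneq wu] => ->;
  by rewrite crossDl !crossZl !crossvv ?scale0r ?scaler0 ?addr0.
Qed.

(** The products of [p1], [p2], [p4] with the displayed vector are [s12 s14], [s12 s24], [s14 s24]
    times the determinant. The first two show that it is nonzero, and the hypotheses make its cross
    product with [p7] vanish. *)
Lemma orthocentre (p1 p2 p4 p7 : 'rV[K]_3) : p7 != 0 -> det3 p1 p2 p4 != 0 ->
  dot p1 p7 * dot p2 p4 = dot p2 p7 * dot p1 p4 ->
  dot p1 p7 * dot p2 p4 = dot p4 p7 * dot p1 p2 ->
  dot p1 p2 != 0 -> dot p1 p4 != 0 \/ dot p2 p4 != 0 ->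
  same_point p7 ((dot p1 p4 * dot p2 p4) *: cross p1 p2
    - (dot p1 p2 * dot p2 p4) *: cross p1 p4
    + (dot p1 p2 * dot p1 p4) *: cross p2 p4).
Proof.
move=> p70 D e1 e2 s12 s; set c := (X in same_point _ X).
have c1 : dot p1 c = dot p1 p2 * dot p1 p4 * det3 p1 p2 p4.
  by rewrite /c /det3 !dotE /cross ?mxE /= ?mxE /=; ring.
have c2 : dot p2 c = dot p1 p2 * dot p2 p4 * det3 p1 p2 p4.
  by rewrite /c /det3 !dotE /cross ?mxE /= ?mxE /=; ring.
apply: same_point_cross => //.
  have nz u : dot u c != 0 -> c != 0 by apply: contraNneq => ->; rewrite dot0r.
  by case: s => s; [apply: (nz p1); rewrite c1 | apply: (nz p2); rewrite c2];
    rewrite !mulf_neq0.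
have -> : cross p7 c = (dot p2 p4 * (dot p2 p7 * dot p1 p4 - dot p4 p7 * dot p1 p2)) *: p1
  - (dot p1 p4 * (dot p1 p7 * dot p2 p4 - dot p4 p7 * dot p1 p2)) *: p2
  + (dot p1 p2 * (dot p1 p7 * dot p2 p4 - dot p2 p7 * dot p1 p4)) *: p4.
  rewrite /c -[- (_ *: _)]scaleNr !(crossDr, crossZr) !double_cross.
  by rewrite !(dotC p7); apply/rowP => i; rewrite !mxE; ring.
by rewrite -e1 -e2 !subrr !mulr0 !scale0r subr0 addr0.
Qed.

(** Since [w] lies on the line of [p] and [q], the vector [cross p w] is a multiple of [cross p q];
    the Binet-Cauchy identity [dot_cross] then turns the scalar relation into orthogonality. *)
Lemma orthogonal_lines_span u v w (p q : 'rV[K]_3) : cross p q != 0 -> det3 w p q = 0 ->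
  dot u p * dot v q = dot u q * dot v p ->
  orthogonal_lines u v p w /\ orthogonal_lines u v w p.
Proof.
move=> pq0 wpq e; rewrite /orthogonal_lines (crossC p w).
have [|x [y ->]] := @det3_eq0_span _ p q w pq0; first by rewrite -det3_rot.
rewrite crossDl !crossZl crossvv scaler0 add0r -scaleNr !dotZr dot_cross.
have -> : dot u q * dot v p - dot u p * dot v q = 0 by rewrite e subrr.
by rewrite !mulr0.
Qed.

End Orthocentre.

(** * From the configuration to a normalised quadrangle *)

Section C8Configuration.

Variables (K : numFieldType) (L : 'rV[K]_3 -> 'rV[K]_3 -> 'rV[K]_3).
Hypothesis LDl : forall u v w, L (u + v) w = L u w + L v w.
Hypothesis LZl : forall k u v, L (k *: u) v = k *: L u v.
Hypothesis LC : forall u v, L u v = L v u.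
Hypothesis Lsym : forall u v w, dot (L u v) w = dot (L u w) v.

Lemma C8_orthocentric (p1 p2 p3 p4 p5 p6 p7 : 'rV[K]_3) :
  ~ (forall u v, L u v = 0) ->
  [/\ p3 != 0, p5 != 0 & p6 != 0] ->
  [/\ det3 p1 p2 p4 != 0, det3 p1 p2 p7 != 0, det3 p1 p4 p7 != 0
    & det3 p2 p4 p7 != 0] ->
  [/\ det3 p1 p2 p3 = 0, det3 p1 p4 p5 = 0 & det3 p1 p6 p7 = 0] ->
  [/\ det3 p2 p4 p6 = 0, det3 p2 p5 p7 = 0 & det3 p3 p4 p7 = 0] ->
  [/\ eigenvec L p1, eigenvec L p2, eigenvec L p3 & eigenvec L p4] ->
  [/\ eigenvec L p5, eigenvec L p6 & eigenvec L p7] ->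
  dot p1 p7 * dot p2 p4 = dot p2 p7 * dot p1 p4 /\
  dot p1 p7 * dot p2 p4 = dot p4 p7 * dot p1 p2.
Proof.
move=> L0 [p30 p50 p60] [D D127 D147 D247] [d123 d145 d167] [d246 d257 d347].
move=> [e1 e2 e3 e4] [e5 e6 e7].
(* The coordinates of [p7] in the basis [p1], [p2], [p4], all nonzero because no three of the four
   vertices are aligned. *)
pose x := det3 p7 p2 p4 / det3 p1 p2 p4; pose y := det3 p1 p7 p4 / det3 p1 p2 p4.
pose z := det3 p1 p2 p7 / det3 p1 p2 p4.
have x0 : x != 0 by rewrite mulf_neq0 ?invr_neq0 // det3_rot.
have y0 : y != 0.
  by rewrite mulf_neq0 ?invr_neq0 // det3_rot det3_swap det3_rot det3_rot oppr_eq0.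
have z0 : z != 0 by rewrite mulf_neq0 ?invr_neq0.
pose a := x *: p1; pose b := y *: p2; pose c := z *: p4.
have p7E : p7 = a + b + c.
  apply: (scalerI D); rewrite cramer3 !scalerDr !scalerA.
  by rewrite ![_ * (_ / _)]mulrC !divfK.
clearbody x y z.
have Dabc : det3 a b c != 0 by rewrite det3Z !mulf_neq0.
have ea : eigenvec L a by apply/(eigenvecZ LZl LC).
have eb : eigenvec L b by apply/(eigenvecZ LZl LC).
have ec : eigenvec L c by apply/(eigenvecZ LZl LC).
(* Each of [p3], [p5], [p6] is the intersection of two opposite sides of the quadrangle, hence a
   multiple of [a + b], [a + c], [b + c] respectively. *)
have [||k3 k30 p3E] := @diagonal_point _ a b c p3 Dabc p30.
- by rewrite -[p3]scale1r det3Z d123 mulr0.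
- by rewrite -p7E -[p3]scale1r -[p7]scale1r det3Z d347 mulr0.
have [|||k5 k50 p5E] := @diagonal_point _ a c b p5 _ p50.
- by rewrite det3_rot det3_swap oppr_eq0 det3_rot det3_rot.
- by rewrite -[p5]scale1r det3Z d145 mulr0.
- by rewrite addrAC -p7E det3_swap -[p5]scale1r -[p7]scale1r det3Z d257 mulr0 oppr0.
have [|||k6 k60 p6E] := @diagonal_point _ b c a p6 _ p60.
- by rewrite det3_rot det3_rot.
- by rewrite -[p6]scale1r det3Z d246 mulr0.
- by rewrite addrC addrA -p7E det3_swap -[p6]scale1r -[p7]scale1r det3Z d167 mulr0 oppr0.
move: e3 e5 e6; rewrite p3E p5E p6E => /(eigenvecZ LZl LC _ k30) e3.
move=> /(eigenvecZ LZl LC _ k50) e5 /(eigenvecZ LZl LC _ k60) e6.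
have e7' : eigenvec L (a + b + c) by rewrite -p7E.
have [] := quadrangle_orthocentric LDl LZl LC Lsym Dabc L0 (And3 ea eb ec)
  (And3 e3 e5 e6) e7'.
rewrite -p7E /a /b /c !(dotZl, dotZr) => E1 E2.
(* The relations are homogeneous in each vertex, so the rescaling only contributes the common factor
   [x * y * z]. *)
have xyz : x * y * z != 0 by rewrite !mulf_neq0.
split; apply: (mulfI xyz).
  by transitivity (x * dot p1 p7 * (y * (z * dot p2 p4))); [|rewrite E1]; ring.
by transitivity (x * dot p1 p7 * (y * (z * dot p2 p4))); [|rewrite E2]; ring.
Qed.

End C8Configuration.

(** * Eigenpoints as eigenvectors *)

Section Eigenpoints.

Variables (K : numFieldType) (f : {mpoly K[3]}).
Variable L : 'rV[K]_3 -> 'rV[K]_3 -> 'rV[K]_3.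
Hypothesis Lgrad : forall u, L u u = 2 *: gradv f u.

(** Up to sign, the minors are the coordinates of the cross product of [p] with the gradient, so
    they vanish exactly when the gradient is a multiple of [p]. *)
Lemma eigenpointP p : eigenpoint f p <-> p != 0 /\ eigenvec L p.
Proof.
have minorE i j :
    (eig_minor f i j).@[p 0] = p 0 i * gradv f p 0 j - p 0 j * gradv f p 0 i.
  by rewrite /eig_minor mevalB !mevalM !mevalXU !mxE.
have two0 : (2 : K) != 0 by rewrite Num.Theory.pnatr_eq0.
split=> -[p0 e]; split=> //.
  have [|k gE] := @cross_eq0_parallel _ (gradv f p) p _ p0.
    apply: row3P; rewrite /cross !mxE /=.
    - by have := e 1 2 isT; rewrite minorE !mxE => /eqP;
        rewrite subr_eq0 => /eqP E; rewrite [X in X - _]mulrC -E mulrC subrr.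
    - by have := e 0 2 isT; rewrite minorE !mxE => /eqP;
        rewrite subr_eq0 => /eqP E; rewrite [X in X - _]mulrC E mulrC subrr.
    - by have := e 0 1 isT; rewrite minorE !mxE => /eqP;
        rewrite subr_eq0 => /eqP E; rewrite [X in X - _]mulrC -E mulrC subrr.
  by exists (2 * k); rewrite Lgrad gE scalerA.
move=> i j _; rewrite minorE; case: e => mu; rewrite Lgrad => gE.
have -> : gradv f p = (2^-1 * mu) *: p by rewrite -scalerA -gE scalerK.
by rewrite !mxE; ring.
Qed.

End Eigenpoints.

(** * Collinear eigenpoints *)

Lemma distinct_points_cross (K : fieldType) (I : eqType) (P : I -> 'rV[K]_3) i j :
  (forall i, P i != 0) -> (forall i j, same_point (P i) (P j) -> i = j) ->
  i != j -> cross (P i) (P j) != 0.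
Proof.
move=> P0 Pinj; apply: contraNneq => c0; apply/eqP/Pinj.
exact: same_point_cross.
Qed.

(** By [eigenvec_line], four eigenpoints on a line would turn the whole line into eigenpoints, more
    than the seven that exist. *)
Lemma eigenpoints_no4_collinear (K : numFieldType) (f : {mpoly K[3]})
    (P : 'I_7 -> 'rV[K]_3) i j k l :
  f \is 3.-homog -> are_eigenpoints f P -> uniq [:: i; j; k; l] ->
  det3 (P i) (P j) (P k) = 0 -> det3 (P i) (P j) (P l) = 0 -> False.
Proof.
move=> /cubic_polarization[L [LDl LZl LC _ [Lgrad _]]] [Peig Pinj Pall].
have eigP := eigenpointP Lgrad.
have P0 m : P m != 0 by case: (Peig m).
have cr := distinct_points_cross P0 Pinj.
rewrite /= !inE !negb_or => /and4P[/and3P[ij ik il] /andP[jk jl] kl _] dk dl.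
have [x [y kE]] := det3_eq0_span (cr _ _ ij) dk.
have [x' [y' lE]] := det3_eq0_span (cr _ _ ij) dl.
have [||x0 y0] := span_coef_neq0 kE; rewrite ?cr 1?eq_sym //.
have [||x'0 y'0] := span_coef_neq0 lE; rewrite ?cr 1?eq_sym //.
(* Representatives are scaled so that [P k = u + v]; then [P l] is a multiple of [u + r *: v], and
   [r] differs from 1 because [P k] and [P l] are distinct. *)
pose u := x *: P i; pose v := y *: P j; pose r := (y' * x) / (y * x').
have uv : cross u v != 0 by rewrite crossZl crossZr !scaler_eq0 !negb_or x0 y0 cr.
have lE' : P l = (x' / x) *: (u + r *: v).
  rewrite lE scalerDr !scalerA divfK //; congr (_ + _ *: _).
  by rewrite /r; field; rewrite x0 y0 x'0.
have x'x : x' / x != 0 by rewrite mulf_neq0 ?invr_neq0.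
have r0 : r != 0 by rewrite !mulf_neq0 ?invr_neq0 ?mulf_neq0.
have r1 : r != 1.
  apply: contraNneq (cr _ _ kl) => r1.
  by rewrite lE' r1 scale1r kE -/u -/v crossZr crossvv scaler0.
have line s : eigenvec L (u + s *: v).
  have ev m : eigenvec L (P m) by case/eigP: (Peig m).
  apply: (eigenvec_line LDl LZl LC s uv r0 r1).
  - exact/(eigenvecZ LZl LC).
  - exact/(eigenvecZ LZl LC).
  - by rewrite /u /v -kE.
  by apply/(eigenvecZ LZl LC _ x'x); rewrite -lE'.
clearbody u v.
(* Eight points of the line, pairwise distinct in characteristic 0, contradict the pigeonhole
   principle for seven eigenpoints. *)
pose Q (s : 'I_8) := u + (s : nat)%:R *: v.
have crQ s t : cross (Q s) (Q t) = ((t : nat)%:R - (s : nat)%:R) *: cross u v.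
  rewrite /Q !(crossDl, crossDr, crossZl, crossZr) !crossvv (crossC v u).
  by apply/rowP => m; rewrite !mxE; ring.
have Q0 s : Q s != 0.
  apply: contraNneq uv => e; have : cross (Q s) v = 0 by rewrite e cross0l.
  by rewrite crossDl crossZl crossvv scaler0 addr0 => ->.
have [|h hE] := @fin_all_exists _ (fun=> 'I_7) (fun s m => same_point (Q s) (P m)).
  by move=> s; apply/Pall/eigP; split; [exact: Q0 | exact: line].
suff : injective h by move/leq_card; rewrite !card_ord.
move=> s t hst; have [_ [a _ sE]] := hE s; have [_ [b _ tE]] := hE t.
have /eqP : cross (Q s) (Q t) = 0.
  by rewrite sE tE hst crossZl crossZr crossvv !scaler0.
rewrite crQ scaler_eq0 (negPf uv) orbF subr_eq0 Num.Theory.eqr_nat => /eqP e.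
exact/esym/val_inj.
Qed.

(** * Relabelling the points and conclusion *)

Lemma idx_eq i j : (0 < i <= 7)%N -> (0 < j <= 7)%N -> (idx i == idx j) = (i == j).
Proof.
by move: i j => [//|i] [//|j] /= i7 j7; rewrite -val_eqE /= !inordK.
Qed.

Local Opaque idx.

Definition orthocentric (K : fieldType) (Q : nat -> 'rV[K]_3) : Prop :=
  let s i j := dot (Q i) (Q j) in
  s 1%N 7%N * s 2%N 4%N = s 2%N 7%N * s 1%N 4%N /\
  s 1%N 7%N * s 2%N 4%N = s 4%N 7%N * s 1%N 2%N.

Lemma orthocentric_C8_conclusion (K : fieldType) (P : 'I_7 -> 'rV[K]_3) :
  let Q k := P (idx k) in
  let s i j := dot (Q i) (Q j) in
  C8 P -> det3 (Q 1%N) (Q 2%N) (Q 4%N) != 0 -> orthocentric Q ->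
  s 1%N 2%N != 0 -> s 1%N 4%N != 0 \/ s 2%N 4%N != 0 ->
  [/\ C8 P, s 1%N 2%N != 0,
      same_point (Q 7%N)
        ((s 1%N 4%N * s 2%N 4%N) *: cross (Q 1%N) (Q 2%N)
         - (s 1%N 2%N * s 2%N 4%N) *: cross (Q 1%N) (Q 4%N)
         + (s 1%N 2%N * s 1%N 4%N) *: cross (Q 2%N) (Q 4%N)),
      [/\ orthogonal_lines (Q 1%N) (Q 2%N) (Q 3%N) (Q 4%N),
          orthogonal_lines (Q 1%N) (Q 4%N) (Q 2%N) (Q 5%N)
        & orthogonal_lines (Q 1%N) (Q 6%N) (Q 2%N) (Q 4%N)]
    & [/\ dot (cross (Q 1%N) (Q 2%N)) (cross (Q 3%N) (Q 4%N)) = 0,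
          dot (cross (Q 1%N) (Q 4%N)) (cross (Q 2%N) (Q 5%N)) = 0
        & dot (cross (Q 1%N) (Q 6%N)) (cross (Q 2%N) (Q 4%N)) = 0]].
Proof.
move=> Q s C D [e1 e2] s12 s14.
have [[P0 Pinj] [[_ _ /aligned_det3 d167] [_ /aligned_det3 d257 /aligned_det3 d347]]] := C.
have cr i j : (0 < i <= 7)%N -> (0 < j <= 7)%N -> i != j -> cross (Q i) (Q j) != 0.
  by move=> i7 j7 ij; apply: (@distinct_points_cross _ _ P); rewrite // idx_eq.
have ortho : [/\ orthogonal_lines (Q 1%N) (Q 2%N) (Q 3%N) (Q 4%N),
    orthogonal_lines (Q 1%N) (Q 4%N) (Q 2%N) (Q 5%N)
  & orthogonal_lines (Q 1%N) (Q 6%N) (Q 2%N) (Q 4%N)].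
  split.
  - have [|||] // := @orthogonal_lines_span _ (Q 1%N) (Q 2%N) (Q 3%N) (Q 4%N) (Q 7%N).
    + exact: cr.
    by rewrite mulrC -e1 mulrC.
  - have [|||] // := @orthogonal_lines_span _ (Q 1%N) (Q 4%N) (Q 5%N) (Q 2%N) (Q 7%N).
    + exact: cr.
    + by rewrite det3_swap d257 oppr0.
    by rewrite (dotC (Q 4%N) (Q 2%N)) e2 mulrC.
  rewrite /orthogonal_lines dotC.
  have [|||] // := @orthogonal_lines_span _ (Q 2%N) (Q 4%N) (Q 6%N) (Q 1%N) (Q 7%N).
  + exact: cr.
  + by rewrite det3_swap d167 oppr0.
  by rewrite (dotC (Q 4%N) (Q 1%N)) (dotC (Q 2%N) (Q 1%N)) -e1 e2 mulrC.
split=> //; apply: orthocentre => //; exact: P0.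
Qed.

(** The relations treat the four vertices symmetrically, so a relabelling can secure the
    nonvanishing conditions. The obstruction to all other cases is that a nonzero vector cannot be
    orthogonal to three independent ones. *)
Lemma C8_eigenpoints_orthocentric (K : numFieldType) (f : {mpoly K[3]})
    (P : 'I_7 -> 'rV[K]_3) :
  f != 0 -> f \is 3.-homog -> are_eigenpoints f P -> C8 P ->
  exists g : 'S_7,
    let Q k := P (g (idx k)) in
    [/\ C8 (fun i => P (g i)), det3 (Q 1%N) (Q 2%N) (Q 4%N) != 0, orthocentric Q,
        dot (Q 1%N) (Q 2%N) != 0
      & dot (Q 1%N) (Q 4%N) != 0 \/ dot (Q 2%N) (Q 4%N) != 0].
Proof.
move=> f0 f3 Peig C; have [[P0 Pinj] [[a123 a145 a167] [a246 a257 a347]]] := C.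
pose p k := P (idx k).
have [d123 d145 d167] := And3 (aligned_det3 a123) (aligned_det3 a145) (aligned_det3 a167).
have [d246 d257 d347] := And3 (aligned_det3 a246) (aligned_det3 a257) (aligned_det3 a347).
have no4 i j k l : all (fun n => 0 < n <= 7)%N [:: i; j; k; l] ->
    uniq [:: i; j; k; l] -> det3 (p i) (p j) (p k) = 0 ->
    det3 (p i) (p j) (p l) != 0.
  move=> /and5P[i7 j7 k7 l7 _] u dk; apply/eqP => dl.
  apply: (eigenpoints_no4_collinear f3 Peig _ dk dl).
  by move: u; rewrite /= !inE !idx_eq.
(* Two of any three vertices are aligned with a diagonal point, so a third vertex on that line would
   be a fourth eigenpoint there. *)
have D124 := no4 1%N 2%N 3%N 4%N isT isT d123.
have D127 := no4 1%N 2%N 3%N 7%N isT isT d123.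
have D147 := no4 1%N 4%N 5%N 7%N isT isT d145.
have D247 := no4 2%N 4%N 6%N 7%N isT isT d246.
have [L [LDl LZl LC Lsym [Lgrad L0]]] := cubic_polarization f3.
have ev k : eigenvec L (p k).
  by case: Peig => /(_ (idx k)) + _ _; rewrite (eigenpointP Lgrad) => -[].
have L00 : ~ (forall u v, L u v = 0) by move=> L00; case/eqP: f0; apply: L0.
have [e1 e2] := C8_orthocentric LDl LZl LC Lsym L00
  (And3 (P0 (idx 3)) (P0 (idx 5)) (P0 (idx 6))) (And4 D124 D127 D147 D247)
  (And3 d123 d145 d167) (And3 d246 d257 d347)
  (And4 (ev 1%N) (ev 2%N) (ev 3%N) (ev 4%N)) (And3 (ev 5%N) (ev 6%N) (ev 7%N)).
have C8_perm (g : 'S_7) :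
    let al i j k := aligned (P (g (idx i))) (P (g (idx j))) (P (g (idx k))) in
    [/\ al 1 2 3, al 1 4 5 & al 1 6 7]%N -> [/\ al 2 4 6, al 2 5 7 & al 3 4 7]%N ->
    C8 (fun i => P (g i)).
  move=> al h1 h2; split=> //; split=> [i|i j /Pinj]; [exact: P0 | exact: perm_inj].
have swap i j k l (m : nat) : uniq [:: i; j; k; l] ->
    all (fun n => 0 < n <= 7)%N [:: i; j; k; l; m] ->
    (tperm (idx i) (idx j) * tperm (idx k) (idx l))%g (idx m) =
    idx (if m == i then j else if m == j then i else if m == k then l
         else if m == l then k else m).
  rewrite /= !inE !negb_or => /and4P[/and3P[ij ik il] /andP[jk jl] kl _].
  move=> /and5P[i7 j7 k7 l7 /andP[m7 _]].
  rewrite permM; have [->|mi] := eqVneq m i;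
    first by rewrite tpermL tpermD // idx_eq // eq_sym.
  have [->|mj] := eqVneq m j; first by rewrite tpermR tpermD // idx_eq // eq_sym.
  rewrite [tperm (idx i) _ _]tpermD ?idx_eq // 1?eq_sym //.
  have [->|mk] := eqVneq m k; first by rewrite tpermL.
  have [->|ml] := eqVneq m l; first by rewrite tpermR.
  by rewrite tpermD // idx_eq // eq_sym.
have swap24 m := @swap 2%N 4%N 3%N 5%N m isT.
have swap27 m := @swap 2%N 7%N 3%N 6%N m isT.
have z127 := det3_dot_eq0 D127; have z147 := det3_dot_eq0 D147.
have z247 := det3_dot_eq0 D247.
have pn k : p k <> 0 by apply/eqP/P0.
have or0 (x y : K) : x * y = 0 -> x = 0 \/ y = 0.
  by move/eqP; rewrite mulf_eq0 => /orP[] /eqP; [left | right].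
move: e1 e2; rewrite -/(p _) => e1 e2.
(* If [s12] is nonzero, the labelling is kept: [s14 = s24 = 0] would give [s47 = 0], making point 4
   orthogonal to 1, 2 and 7. *)
have [s12|s12] := eqVneq (dot (p 1%N) (p 2%N)) 0; last first.
  exists 1%g; rewrite /orthocentric !perm1.
  split; [by apply: C8_perm; rewrite !perm1 | by [] | by [] | by [] |].
  have [s14|] := eqVneq (dot (p 1%N) (p 4%N)) 0; last by left.
  have [s24|] := eqVneq (dot (p 2%N) (p 4%N)) 0; last by right.
  case: (pn 4%N); apply: z127 => //; rewrite dotC //; apply: (mulIf s12).
  by rewrite -e2 s24 mulr0 mul0r.
move: e1; rewrite e2 s12 mulr0 => /esym e1; rewrite s12 mulr0 in e2.
(* With [s12 = 0] and [s14] nonzero, exchanging 2 with 4 and 3 with 5 works; [s24 = 0] would make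
   point 2 orthogonal to 1, 4 and 7. *)
have [s14|s14] := eqVneq (dot (p 1%N) (p 4%N)) 0; last first.
  have s27 : dot (p 2%N) (p 7%N) = 0 by case/or0: e1 => // /eqP; rewrite (negPf s14).
  exists (tperm (idx 2) (idx 4) * tperm (idx 3) (idx 5))%g.
  rewrite /orthocentric !swap24 //=; split; last 1 first.
  - by right; apply/eqP => s24; case: (pn 2%N); apply: z147; rewrite // dotC //.
  - by apply: C8_perm; rewrite !swap24 //=; split=> //; apply: aligned_swap12.
  - by rewrite det3_rot det3_swap oppr_eq0 det3_rot det3_rot.
  - by rewrite -!/(p _) (dotC (p 4%N) (p 2%N)) e1 e2 s12 mulr0.
  by [].
(* With only [s24] nonzero, point 1 would be orthogonal to 2, 4 and 7. *)
have [s24|s24] := eqVneq (dot (p 2%N) (p 4%N)) 0; last first.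
  have s17 : dot (p 1%N) (p 7%N) = 0 by case/or0: e2 => // /eqP; rewrite (negPf s24).
  by case: (pn 1%N); apply: z247; rewrite // dotC.
have s17 : dot (p 1%N) (p 7%N) != 0.
  by apply/eqP => s17; case: (pn 1%N); apply: z247; rewrite // dotC.
have s47 : dot (p 7%N) (p 4%N) != 0.
  by apply/eqP => s47; case: (pn 4%N); apply: z127.
(* When 1, 2, 4 are mutually orthogonal, point 7 takes the place of 2, and [s17], [s47] become the
   required nonzero products. *)
exists (tperm (idx 2) (idx 7) * tperm (idx 3) (idx 6))%g.
rewrite /orthocentric !swap27 //=; split; [| | | exact: s17 | by right].
- apply: C8_perm; rewrite !swap27 //=; split=> //;
    by [apply: aligned_swap23 | apply: aligned_swap13].
- by rewrite det3_rot det3_swap oppr_eq0 det3_rot det3_rot.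
by rewrite -!/(p _) (dotC (p 4%N) (p 2%N)) s24 s12 s14 !(mulr0, mul0r).
Qed.

Theorem proposition7p8 (R : realType) (f : {mpoly R[i][3]})
    (P : 'I_7 -> 'rV[R[i]]_3) :
  f != 0 -> f \is 3.-homog -> regular_form f ->
  are_eigenpoints f P -> C8 P ->
  exists sigma : 'S_7,
    let Q (k : nat) := P (sigma (idx k)) in
    let s (i j : nat) := dot (Q i) (Q j) in
    [/\ C8 (fun i => P (sigma i)),
        s 1%N 2%N != 0,
        same_point (Q 7%N)
          ((s 1%N 4%N * s 2%N 4%N) *: cross (Q 1%N) (Q 2%N)
           - (s 1%N 2%N * s 2%N 4%N) *: cross (Q 1%N) (Q 4%N)
           + (s 1%N 2%N * s 1%N 4%N) *: cross (Q 2%N) (Q 4%N)),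
        [/\ orthogonal_lines (Q 1%N) (Q 2%N) (Q 3%N) (Q 4%N),
            orthogonal_lines (Q 1%N) (Q 4%N) (Q 2%N) (Q 5%N)
          & orthogonal_lines (Q 1%N) (Q 6%N) (Q 2%N) (Q 4%N)]
      & [/\ dot (cross (Q 1%N) (Q 2%N)) (cross (Q 3%N) (Q 4%N)) = 0,
            dot (cross (Q 1%N) (Q 4%N)) (cross (Q 2%N) (Q 5%N)) = 0
          & dot (cross (Q 1%N) (Q 6%N)) (cross (Q 2%N) (Q 4%N)) = 0]].
Proof.
move=> f0 f3 _ Peig C.
have [g [C8g Dg og h12 h]] := C8_eigenpoints_orthocentric f0 f3 Peig C.
by exists g; apply: (orthocentric_C8_conclusion C8g).
Qed.
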